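(* Let $1\le q\le\infty$. If $\mathcal{B}$ is a right-sided reproducing kernel Banach space of functions on $\Omega$ with the right-sided reproducing kernel $K\in L_0(\Omega\times\Omega')$ such that the map $x\mapsto\|K(x,\cdot)\|_{\mathcal{B}'}$ belongs to $L_q(\Omega)$, then the identity map from $\mathcal{B}$ into $L_q(\Omega)$ is continuous.
   Context: $\Omega,\Omega'$ are locally compact Hausdorff spaces equipped with regular Borel measures $\mu,\mu'$; $L_q(\Omega)$ is the standard Lebesgue space with respect to $\mu$. $L_0(X)$ denotes the set of real-valued measurable functions on $X$ (genuine functions). The identity map sends $f\in\mathcal{B}$ to its $\mu$-almost everywhere equivalence class. For a Banach space $\mathcal{B}$, $\mathcal{B}'$ is its continuous dual and $\langle f,G\rangle_{\mathcal{B}}:=G(f)$. Right-sided reproducing kernel Banach space: let $K\in L_0(\Omega\times\Omega')$ and let $\mathcal{B}$ be a Banach space consisting of functions in $L_0(\Omega)$ whose dual $\mathcal{B}'$ is isometrically isomorphic to a normed space $\mathcal{F}$ consisting of functions in $L_0(\Omega')$; $\mathcal{F}$ is fixed and identified with $\mathcal{B}'$. $\mathcal{B}$ is a right-sided reproducing kernel Banach space with right-sided reproducing kernel $K$ if $K(x,\cdot)\in\mathcal{F}\cong\mathcal{B}'$ for each $x\in\Omega$, and $\langle f,K(x,\cdot)\rangle_{\mathcal{B}}=f(x)$ for all $f\in\mathcal{B}$ and all $x\in\Omega$. *)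

(* Defs.v *)
From HB Require Import structures.
From mathcomp Require Import all_boot all_order all_algebra.
From mathcomp Require Import all_classical all_reals all_analysis.
From mathcomp Require Import measurable_realfun.
Import Order.TTheory GRing.Theory Num.Theory.
Import numFieldNormedType.Exports.
Set Implicit Arguments.
Unset Strict Implicit.
Unset Printing Implicit Defensive.
Local Open Scope classical_set_scope.
Local Open Scope ring_scope.
Local Open Scope quotient_scope.

Notation borel X := (g_sigma_algebraType (@open X)).

(* Genuine functions, not classes. For a product space, borel (X * Y) is the
   Borel sigma-algebra of the product topology; it contains the product
   sigma-algebra, so this is the weaker measurability requirement. *)
Notation L0 R X := {mfun borel X >-> R}.

(* Outer regular by open sets and inner regular by compact sets, on every Borel
   set; finiteness on compact sets is not part of the notion. *)
Definition regular_measure (R : realType) (X : ptopologicalType)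
    (mu : {measure set (borel X) -> \bar R}) : Prop :=
  forall A : set (borel X), measurable A ->
    mu A = ereal_inf [set mu U | U in [set U : set X | open U /\ A `<=` U]] /\
    mu A = ereal_sup [set mu C | C in [set C : set X | compact C /\ C `<=` A]].

(* The continuous dual of V as a normed space, with the operator norm. *)
Section Dual.
Context {R : realType} (V : normedModType R).

Definition continuous_functional : {pred V -> R^o} :=
  mem [set G : V -> R^o | linear G /\ continuous G].

Lemma continuous_functional_submod : submod_closed continuous_functional.
Proof.
split.
  rewrite inE; split=> [a u v|]; last exact: cst_continuous.
  by rewrite /= scaler0 addr0.
move=> a F G; rewrite !inE => -[lF cF] [lG cG]; split=> [b u v|x].
  rewrite -[LHS]/(a *: F _ + G _) -[RHS]/(b *: (a *: F u + G u) + (a *: F v + G v)).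
  by rewrite lF lG !scalerDr !scalerA (mulrC b) addrACA.
by apply: cvgD; [apply: cvgZl_tmp; exact: cF|exact: cG].
Qed.

HB.instance Definition _ := GRing.isSubmodClosed.Build _ _
  continuous_functional continuous_functional_submod.

Record dual := Dual {
  dual_val :> V -> R^o;
  dual_valP : dual_val \in continuous_functional }.

HB.instance Definition _ := [isSub for dual_val].
HB.instance Definition _ := [Choice of dual by <:].
HB.instance Definition _ := [SubChoice_isSubLmodule of dual by <:].

Definition dual_norm (G : dual) : R :=
  sup [set `|G v| | v in [set v : V | `|v| <= 1]].

Lemma dual_linear (G : dual) : linear G.
Proof. by have := dual_valP G; rewrite inE => -[]. Qed.

Lemma dual_continuous (G : dual) : continuous G.
Proof. by have := dual_valP G; rewrite inE => -[]. Qed.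

HB.instance Definition _ (G : dual) :=
  GRing.isLinear.Build R V R^o *:%R G (dual_linear G).

Lemma dual_has_sup (G : dual) :
  has_sup [set `|G v| | v in [set v : V | `|v| <= 1]].
Proof.
split; first by exists `|G 0|, 0 => //=; rewrite normr0.
have /linear_bounded_continuous/linear_boundedP := @dual_continuous G.
move=> /pinfty_ex_gt0[M M0 GM].
exists M => _ [v v1 <-]; rewrite (le_trans (GM v))//.
by rewrite ler_piMr// ltW.
Qed.

Lemma dual_norm_ub (G : dual) v : `|v| <= 1 -> `|G v| <= dual_norm G.
Proof. by move=> v1; apply: (ub_le_sup (dual_has_sup G).2); exists v. Qed.

Lemma dual_norm_ge0 (G : dual) : 0 <= dual_norm G.
Proof.
by apply: le_trans (@dual_norm_ub G 0 _); rewrite ?normr_ge0// normr0.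
Qed.

Lemma dual_norm_lub (G : dual) M :
  (forall v, `|v| <= 1 -> `|G v| <= M) -> dual_norm G <= M.
Proof.
move=> GM; apply: ge_sup; first exact: (dual_has_sup G).1.
by move=> _ [v v1 <-]; exact: GM.
Qed.

Lemma dual_normP (G : dual) v : `|G v| <= dual_norm G * `|v|.
Proof.
have [->|v0] := eqVneq v 0; first by rewrite linear0 !normr0 mulr0.
have nv0 : 0 < `|v| by rewrite normr_gt0.
rewrite -ler_pdivrMr//.
have := @dual_norm_ub G (`|v|^-1 *: v); rewrite linearZ !normrZ normfV normr_id.
by rewrite mulVf ?gt_eqF// mulrC; apply.
Qed.

Lemma dual_ler_normD (F G : dual) :
  dual_norm (F + G) <= dual_norm F + dual_norm G.
Proof.
apply: dual_norm_lub => v v1.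
by rewrite (le_trans (ler_normD _ _))// lerD// dual_norm_ub.
Qed.

Lemma dual_normZ (a : R) (G : dual) : dual_norm (a *: G) = `|a| * dual_norm G.
Proof.
have le b (H : dual) : dual_norm (b *: H) <= `|b| * dual_norm H.
  apply: dual_norm_lub => v v1.
  by rewrite [X in `|X|]/(b *: H v) normrZ ler_wpM2l// dual_norm_ub.
apply/eqP; rewrite eq_le le/=.
have [->|a0] := eqVneq a 0; first by rewrite normr0 mul0r dual_norm_ge0.
rewrite -ler_pdivlMl ?normr_gt0// -normfV.
by apply: le_trans (le _ _); rewrite scalerA mulVf// scale1r.
Qed.

Lemma dual_norm0_eq0 (G : dual) : dual_norm G = 0 -> G = 0.
Proof.
move=> G0; apply/val_inj/funext => v; apply/eqP.
by rewrite -normr_le0 (le_trans (dual_normP G v))// G0 mul0r.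
Qed.

HB.instance Definition _ := Lmodule_isNormed.Build R dual
  dual_ler_normD dual_normZ dual_norm0_eq0.

End Dual.

(* MathComp-Analysis gives L_q as a set of classes, without a topology; we
   equip it with the distance induced by the L_q-norm. *)
Section LqMetric.
Context d (T : measurableType d) (R : realType).
Variables (mu : {measure set T -> \bar R}) (q : \bar R) (q1 : (1 <= q)%E).
Local Notation Lq := (LspaceType mu q1).
Implicit Types f g h : Lq.

HB.instance Definition _ := gen_eqMixin Lq.
HB.instance Definition _ := gen_choiceMixin Lq.

Definition Lq_dist f g : R := fine 'N[mu]_q[EFin \o (f \- g)%R].

Lemma Lspace_Lfun f : (f : T -> R) \in Lfun mu q.
Proof.
apply/andP; split; rewrite inE; last exact: (@Lebesgue_finite _ _ _ _ _ _ f).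
exact: (@measurable_funPT _ _ _ _ (repr (f : {mfun_ mu, T >-> measurableTypeR R}))).
Qed.

Lemma LspaceB_Lfun f g : (f \- g : T -> R) \in Lfun mu q.
Proof. exact: (rpredB (Lspace_Lfun f) (Lspace_Lfun g)). Qed.

Lemma Lq_distxx f : Lq_dist f f = 0.
Proof.
rewrite /Lq_dist (@eq_Lnorm _ _ _ _ _ _ (cst 0%E)).
  by rewrite Lnorm0// gt_eqF// (lt_le_trans _ q1).
by move=> x /=; rewrite subrr.
Qed.

Lemma Lq_dist_eq0 f g : Lq_dist f g = 0 -> f = g.
Proof.
move=> /(@fine_Lnormr_eq0 _ _ _ _ _ q1 (Lfun_Sub q1 (LspaceB_Lfun f g))) fg0.
have /ae_eqP/eqP : (f : {mfun_ mu, T >-> measurableTypeR R}) = g %[ae mu].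
  by apply: filterS fg0 => x /(_ I) /= /subr0_eq fgx _.
rewrite !reprK.
case: f g {fg0} => [f [[pf]]] [g [[pg]]] /= fg.
by move: pf pg; rewrite fg => pf pg; rewrite (Prop_irrelevance pf pg).
Qed.

Lemma Lq_dist_sym f g : Lq_dist f g = Lq_dist g f.
Proof.
rewrite /Lq_dist -(LnormrN (Lfun_Sub q1 (LspaceB_Lfun g f))); congr fine.
by apply: eq_Lnorm => x /=; rewrite opprB.
Qed.

Lemma Lq_dist_triangle g f h : Lq_dist f h <= Lq_dist f g + Lq_dist g h.
Proof.
have := ler_LnormD (Lfun_Sub q1 (LspaceB_Lfun f g))
  (Lfun_Sub q1 (LspaceB_Lfun g h)).
apply: le_trans; rewrite le_eqVlt /Lq_dist; apply/orP; left; apply/eqP.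
by congr fine; apply: eq_Lnorm => x /=; rewrite addrA subrK.
Qed.

HB.instance Definition _ := isMetric.Build R Lq
  Lq_distxx Lq_dist_eq0 Lq_dist_sym Lq_dist_triangle.

End LqMetric.

Section AeClass.
Context d (T : measurableType d) (R : realType).
Variable mu : {measure set T -> \bar R}.
Implicit Types f : {mfun T >-> R}.

(* f itself: R and measurableTypeR R have the same carrier and the same
   measurable sets, but different displays. *)
Definition mfun_measurableTypeR f : T -> measurableTypeR R := f.

HB.instance Definition _ f := isMeasurableFun.Build _ _ T (measurableTypeR R)
  (mfun_measurableTypeR f) (@measurable_funPT _ _ _ _ f).

Definition ae_class f : {mfun_ mu, T >-> measurableTypeR R} :=
  \pi_({mfun_ mu, T >-> measurableTypeR R}) (mfun_measurableTypeR f).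

End AeClass.

Definition isometric_isomorphism (R : realType) (V W : normedModType R)
    (f : {linear V -> W}) : Prop :=
  bijective f /\ forall v, `|f v| = `|v|.

(* "B consists of functions on X" is rendered by an injective linear map incB
   into L0 R X, evaluation of f : B at x being incB f x; likewise F and incF.
   Phi is the identification of F with the dual of B, and sec x is the element
   of F whose underlying function is K(x, .), unique since incF is injective.
   Hence <f, K(x, .)>_B is Phi (sec x) f. *)
Record right_rkbs (R : realType) (X Y : ptopologicalType)
    (B : completeNormedModType R) (F : normedModType R)
    (incB : {linear B -> L0 R X}) (incF : {linear F -> L0 R Y})
    (Phi : {linear F -> dual B}) (K : L0 R (X * Y)%type) (sec : X -> F) :
    Prop := {
  rkbs_incB_inj : injective incB;
  rkbs_incF_inj : injective incF;
  rkbs_dual : isometric_isomorphism Phi;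
  rkbs_kernel_mem : forall x y, incF (sec x) y = K (x, y);
  rkbs_reproducing : forall f x, Phi (sec x) f = incB f x }.

(* Main.v *)
Require Import Defs.
From HB Require Import structures.
From mathcomp Require Import all_boot all_order all_algebra.
From mathcomp Require Import all_classical all_reals all_analysis.
From mathcomp Require Import measurable_realfun.
From mathcomp Require Import ess_sup_inf.
Import Order.TTheory GRing.Theory Num.Theory.
Import numFieldNormedType.Exports.
Set Implicit Arguments.
Unset Strict Implicit.
Unset Printing Implicit Defensive.
Local Open Scope classical_set_scope.
Local Open Scope ring_scope.

(** Write k(x) for the dual norm of K(x, .). Evaluation at x is the functional K(x, .), so |f(x)| <=
    ||f|| k(x) for every f in B and every x. As k lies in L_q, monotonicity of the L_q-norm
    ([ae_le_Lnorm]) puts the class of f in L_q with norm at most ||f|| ||k||_q. Applied to u - v,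
    the same bound makes the identity map Lipschitz with constant ||k||_q, hence continuous.
    Elements of L_q are classes, read as functions through chosen representatives; [ae_class_ae_eq]
    transfers the pointwise bound to these. *)

Section Lq_bounds.
Context d (T : measurableType d) (R : realType).
Variable mu : {measure set T -> \bar R}.

Lemma ae_le_Lnorm (q : \bar R) (f g : T -> R) : (1 <= q)%E ->
  measurable_fun setT f -> measurable_fun setT g ->
  (\forall x \ae mu, `|f x| <= `|g x|) ->
  ('N[mu]_q[EFin \o f] <= 'N[mu]_q[EFin \o g])%E.
Proof.
case: q => [r|_|//]; rewrite unlock; last first.
  (* For q = +oo the norm is 0 by convention when the whole space has measure 0; otherwise it is an
     essential supremum. *)
  move=> mf mg fg; case: ifPn => // _; apply: le_ess_sup.
  by apply: filterS fg => x; rewrite /= lee_fin.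
rewrite lee_fin => r1 mf mg fg.
have r0 : 0 < r by exact: lt_le_trans r1.
have mnorm (h : T -> R) : measurable_fun setT h ->
    measurable_fun setT (fun x => `|(EFin \o h) x| `^ r)%E.
  move=> mh; apply/measurable_EFinP.
  by apply: (@measurableT_comp _ _ _ _ _ _ (@powR R ^~ r)) => //;
    exact: measurableT_comp.
apply: gt0_ler_poweR.
- by rewrite invr_ge0 ltW.
- by rewrite in_itv/= leey integral_ge0// => x _; exact: poweR_ge0.
- by rewrite in_itv/= leey integral_ge0// => x _; exact: poweR_ge0.
apply: ae_ge0_le_integral => //; try exact: mnorm.
- by move=> x _; exact: poweR_ge0.
- by move=> x _; exact: poweR_ge0.
- by apply: filterS fg => x fgx _ /=;
    rewrite lee_fin ge0_ler_powR ?nnegrE// ltW.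
Qed.

(** The chosen representative need not be [f], but it has the same class, and equality of classes is
    equality almost everywhere. *)
Lemma ae_class_ae_eq (f : {mfun T >-> R}) :
  \forall x \ae mu, ae_class mu f x = f x.
Proof.
have /eqmodP/asboolP : \pi_({mfun_ mu, T >-> measurableTypeR R})%qT
    (repr (ae_class mu f)) = \pi_({mfun_ mu, T >-> measurableTypeR R})%qT
    (mfun_measurableTypeR f : {mfun T >-> measurableTypeR R}).
  by rewrite reprK.
by apply: filterS => x /(_ I).
Qed.

End Lq_bounds.

Section Lq_class.
Context d (T : measurableType d) (R : realType).
Variables (mu : {measure set T -> \bar R}) (q : \bar R) (q1 : (1 <= q)%E).

(** The finiteness proof is attached to the class without changing it, so the equation required of
    [J] holds by conversion. *)
Definition Lq_class (f : {mfun T >-> R})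
    (fq : finite_norm mu q (ae_class mu f)) : LspaceType mu q1 :=
  HB.pack_for (LspaceType mu q1) (ae_class mu f)
    (isFinLebesgue.Build _ T R mu q q1 (ae_class mu f) fq).

End Lq_class.

Lemma lipschitz_metric_continuous (R : realType) (V : normedModType R)
    (M : metricType R) (J : V -> M) (C : R) :
  (forall u v, mdist (J u) (J v) <= C * `|u - v|) -> continuous J.
Proof.
move=> JC u; apply/cvg_ballP => e e0.
(* [C] may be zero or negative; this positive upper bound can be divided by, giving the radius e /
   (|C| + 1). *)
have C0 : 0 < `|C| + 1 by rewrite ltr_wpDl.
near=> v.
rewrite ballEmdist/= (le_lt_trans (JC _ _))//.
rewrite (@le_lt_trans _ _ ((`|C| + 1) * `|u - v|))//.
  by rewrite ler_wpM2r// (le_trans (ler_norm C))// lerDl.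
rewrite -ltr_pdivlMl// mulrC; near: v.
by apply: cvgr_dist_lt; rewrite ?divr_gt0//; exact: cvg_id.
Unshelve. all: by end_near. Qed.

Theorem proposition2p14 (R : realType) (X Y : ptopologicalType)
    (X_lc : locally_compact [set: X]) (X_hausdorff : hausdorff_space X)
    (Y_lc : locally_compact [set: Y]) (Y_hausdorff : hausdorff_space Y)
    (mu : {measure set (borel X) -> \bar R}) (mu_regular : regular_measure mu)
    (nu : {measure set (borel Y) -> \bar R}) (nu_regular : regular_measure nu)
    (q : \bar R) (q1 : (1 <= q)%E)
    (B : completeNormedModType R) (F : normedModType R)
    (incB : {linear B -> L0 R X}) (incF : {linear F -> L0 R Y})
    (Phi : {linear F -> dual B}) (K : L0 R (X * Y)%type) (sec : X -> F)
    (B_rkbs : right_rkbs incB incF Phi K sec)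
    (K_Lq : (fun x : borel X => `|Phi (sec x)|) \in Lfun mu q) :
  exists J : B -> LspaceType mu q1,
    (forall f : B, J f = ae_class mu (incB f)
                     :> {mfun_ mu, borel X >-> measurableTypeR R}) /\
    continuous J.
Proof.
set k : borel X -> R := fun x => `|Phi (sec x)| in K_Lq *.
have k_scaled (c : R) : c \*: k \in Lfun mu q.
  exact: (rpredZ c (K_Lq : k \in @Lfun _ _ R mu q)).
have Lfun_fin h : h \in Lfun mu q -> ('N[mu]_q[EFin \o h] < +oo)%E.
  by case/andP => _; rewrite inE.
have Lfun_meas h : h \in Lfun mu q -> measurable_fun setT h.
  by case/andP; rewrite inE.
(* The key estimate: the reproducing property followed by the operator-norm inequality. *)
have incB_le f x : `|incB f x| <= `|f| * k x.
  by rewrite -(rkbs_reproducing B_rkbs) mulrC; exact: dual_normP.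
have J_fin f : finite_norm mu q (ae_class mu (incB f)).
  apply: le_lt_trans (Lfun_fin _ (k_scaled `|f|)).
  apply: ae_le_Lnorm => //.
  - exact: measurable_funPT (repr (ae_class mu (incB f))).
  - exact: Lfun_meas.
  - apply: filterS (ae_class_ae_eq mu (incB f)) => x ->.
    by rewrite (le_trans (incB_le f x))//= ler_norm.
exists (fun f => Lq_class q1 (J_fin f)); split => //.
apply: (@lipschitz_metric_continuous _ _ _ _ (fine 'N[mu]_q[EFin \o k])) => u v.
rewrite -[mdist _ _]/(Lq_dist _ _) /Lq_dist.
(* Homogeneity of the norm; finiteness of ||k||_q lets it be read as a real Lipschitz constant. *)
have NkE : 'N[mu]_q[EFin \o (`|u - v| \*: k)%R]%E =
    (`|u - v| * fine 'N[mu]_q[EFin \o k]%E)%:E.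
  rewrite -[k]/(Lfun_Sub q1 K_Lq : _ -> _) LnormZ normr_id EFinM.
  by rewrite (finite_norm_fine (Lfun_Sub q1 K_Lq)).
rewrite mulrC -[leRHS]/(fine (_%:E)) -NkE; apply: fine_le.
- rewrite ge0_fin_numE ?Lnorm_ge0//; exact: Lfun_fin (LspaceB_Lfun _ _).
- by rewrite NkE.
apply: ae_le_Lnorm => //.
- exact: Lfun_meas (LspaceB_Lfun _ _).
- exact: Lfun_meas.
(* Off a null set both representatives agree with the functions themselves, whose difference is
   [incB (u - v)] by linearity. *)
- apply: filterS2 (ae_class_ae_eq mu (incB u)) (ae_class_ae_eq mu (incB v)).
  move=> x /= -> ->; have := incB_le (u - v) x.
  by rewrite linearB => /le_trans; apply; exact: ler_norm.
Qed.
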